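(* Let $a,b$ be nonnegative integers and let $D(a,b)$ be the diaster with parameters $a,b$. If $a\neq b$ and $a,b\geq 1$, then the number of isotemporal classes of $D(a,b)$ is $\mathcal{N}(D(a,b))=ab+a+b+1$. If $a=b$, then $\mathcal{N}(D(a,a))=\frac{1}{2}(a^2+3a+2)$.
   Context: A temporal network $N=(V,E,\tau)$ is a finite graph $(V,E)$ together with a bijection $\tau:E\to\{1,2,\ldots,|E|\}$ (the temporal labels). A temporal path of length $k$ is a sequence of edges $\langle\{v_1,v_2\},\{v_2,v_3\},\ldots,\{v_k,v_{k+1}\}\rangle$ of the graph whose labels are strictly increasing along the sequence. Two temporal networks $N=(V,E,\tau)$ and $M=(V',E',\tau')$ are temporally isomorphic if there is a graph isomorphism $\phi:V\to V'$ such that for every temporal path $\langle\{v_1,v_2\},\ldots,\{v_k,v_{k+1}\}\rangle$ of $N$, the sequence $\langle\{\phi(v_1),\phi(v_2)\},\ldots,\{\phi(v_k),\phi(v_{k+1})\}\rangle$ is a temporal path of $M$. An isotemporal class is an equivalence class of temporally isomorphic temporal networks. For a graph $G$, $\mathcal{N}(G)$ denotes the number of isotemporal classes among all temporal networks whose underlying graph is isomorphic to $G$ (i.e. over all labelings $\tau$). The diaster $D(a,b)$ is the tree consisting of two adjacent vertices $u,w$ (the edge $\{u,w\}$ is the central edge), together with $a$ further vertices of degree $1$ each adjacent to $u$ and $b$ further vertices of degree $1$ each adjacent to $w$ (the peripheral edges); $D(a,b)=D(b,a)$. *)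

(* Defs.v *)
From mathcomp Require Import all_boot all_order all_algebra.
From mathcomp Require Import boolp.

Set Implicit Arguments.
Unset Strict Implicit.
Unset Printing Implicit Defensive.

Record graph := Graph {
  vertex :> finType;
  adj : rel vertex;
  adj_sym : symmetric adj;
  adj_irrefl : irreflexive adj }.

Definition edge_set (G : graph) : {set {set G}} :=
  [set [set x; y] | x in G, y in G & adj x y].

Definition edge (G : graph) := {e : {set G} | e \in edge_set G}.

Definition graph_iso (G H : graph) (phi : G -> H) : Prop :=
  bijective phi /\ forall x y, adj (phi x) (phi y) = adj x y.

(* A bijection onto 'I_m stands for a bijection onto {1, ..., m}: the temporal
   label of an edge is the successor of its image, see [label]. *)
Definition labeling (G : graph) :=
  {tau : {ffun edge G -> 'I_#|edge_set G|} | `[< bijective tau >]}.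

Record temporal_network := TemporalNetwork {
  network_graph :> graph;
  network_labeling : labeling network_graph }.

(* The value 0 on sets that are not edges is never used. *)
Definition label (N : temporal_network) (e : {set N}) : nat :=
  if insub e is Some f then (val (network_labeling N) f).+1 else 0.

Definition path_edges (T : finType) (v : T) (p : seq T) : seq {set T} :=
  pairmap (fun x y => [set x; y]) v p.

(* The path runs through the vertices v :: p, so its length is [size p]. *)
Definition temporal_path (N : temporal_network) (v : N) (p : seq N) : bool :=
  path (@adj N) v p && sorted ltn [seq label e | e <- path_edges v p].

Definition temporally_isomorphic (N M : temporal_network) : Prop :=
  exists2 phi : N -> M, graph_iso phi &
    forall v p, temporal_path v p -> temporal_path (phi v) (map phi p).

Definition isotemporal (G : graph) : rel (labeling G) :=
  fun s t => `[< temporally_isomorphic (TemporalNetwork s) (TemporalNetwork t) >].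

(* Only the labelings of G itself are considered; by [relabel] below, every
   temporal network on a graph isomorphic to G is temporally isomorphic to one
   of these. *)
Definition isotemporal_classes (G : graph) : {set {set labeling G}} :=
  equivalence_partition (@isotemporal G) [set: labeling G].

Definition num_isotemporal_classes (G : graph) : nat :=
  #|isotemporal_classes G|.

(* [inl false] is u, [inl true] is w, [inr (inl i)] are the leaves at u and
   [inr (inr j)] the leaves at w. *)
Definition diaster_vertex (a b : nat) : finType := (bool + ('I_a + 'I_b))%type.

Definition diaster_adj (a b : nat) : rel (diaster_vertex a b) :=
  fun x y => match x, y with
  | inl c, inl d => c != d
  | inl c, inr (inl _) | inr (inl _), inl c => ~~ c
  | inl c, inr (inr _) | inr (inr _), inl c => c
  | inr _, inr _ => false
  end.

Lemma diaster_adj_sym a b : symmetric (@diaster_adj a b).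
Proof. by move=> [c|[i|i]] [d|[j|j]] //=; rewrite eq_sym. Qed.

Lemma diaster_adj_irrefl a b : irreflexive (@diaster_adj a b).
Proof. by move=> [c|[i|i]] //=; rewrite eqxx. Qed.

Definition diaster (a b : nat) : graph :=
  Graph (@diaster_adj_sym a b) (@diaster_adj_irrefl a b).

Lemma edge_setP (G : graph) (x y : G) :
  ([set x; y] \in edge_set G) = adj x y.
Proof.
apply/imset2P/idP => [[x' y' _]|xy]; last by exists x y; rewrite ?inE.
rewrite inE /= => x'y' /setP E.
have := E x; have := E y; have := E x'; have := E y'.
rewrite !inE !eqxx !orbT /= => /esym H1 /esym H2 /esym H3 /esym H4.
have nx : x' != y' by apply: contraTneq x'y' => ->; rewrite adj_irrefl.
case/orP: H4 => /eqP ?; subst; case/orP: H3 => /eqP ?; subst => //.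
- by move: H1; rewrite !orbb eq_sym (negPf nx).
- by rewrite adj_sym.
- by move: H2; rewrite !orbb (negPf nx).
Qed.

Lemma label_inj (N : temporal_network) :
  {in edge_set N &, injective (@label N)}.
Proof.
move=> e f eE fE; rewrite /label !insubT => -[] /val_inj.
by have /asboolP/bij_inj inj := valP (network_labeling N) => /inj [].
Qed.

Lemma temporal_path_cons (N : temporal_network) (x y z : N) p :
  temporal_path x [:: y, z & p] =
  [&& adj x y, label [set x; y] < label [set y; z] & temporal_path y (z :: p)].
Proof.
rewrite /temporal_path /=; case: (adj x y) => //=.
by case: (_ < _) => //=; rewrite ?andbF.
Qed.

Lemma temporally_isomorphic_refl N : temporally_isomorphic N N.
Proof.
exists id => [|v p]; last by rewrite map_id.
by split=> //; exists id.
Qed.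

Lemma temporally_isomorphic_trans N M L :
  temporally_isomorphic N M -> temporally_isomorphic M L ->
  temporally_isomorphic N L.
Proof.
move=> [f [bf af] pf] [g [bg ag] pg]; exists (g \o f).
  by split=> [|x y /=]; [exact: bij_comp | rewrite ag af].
by move=> v p /pf/pg; rewrite -map_comp.
Qed.

Lemma temporally_isomorphic_sym N M :
  temporally_isomorphic N M -> temporally_isomorphic M N.
Proof.
move=> [f [[g fK gK] af] pf].
have ag x y : adj (g x) (g y) = adj x y by rewrite -af !gK.
exists g; first by split=> //; exists f.
move=> v p; elim: p v => [|y [|z p] IH] x //.
  by rewrite /temporal_path /= !andbT ag.
rewrite !temporal_path_cons ag => /and3P[xy lt yzp].
rewrite xy IH // andbT /=.
have yz : adj y z by case/andP: yzp => /andP[].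
case: ltngtP => // [gt|eq].
- have := pf (g z) [:: g y; g x].
  rewrite temporal_path_cons /temporal_path /= !ag !gK.
  rewrite [adj z y]adj_sym yz [adj y x]adj_sym xy /= andbT.
  rewrite [[set g z; _]]setUC [[set g y; g x]]setUC gt => /(_ isT).
  by rewrite [[set z; _]]setUC [[set y; x]]setUC ltnNge ltnW.
- have /setP E : [set g x; g y] = [set g y; g z].
    by apply: label_inj; rewrite ?edge_setP ?ag.
  have := E (g x); rewrite !inE eqxx /= => /esym/orP[] /eqP /(can_inj gK) xE.
    by move: xy; rewrite xE adj_irrefl.
  by move: lt; rewrite xE setUC ltnn.
Qed.

Lemma isotemporal_equiv (G : graph) : equivalence_rel (@isotemporal G).
Proof.
move=> s t u; split; first exact/asboolP/temporally_isomorphic_refl.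
move=> /asboolP st; apply/asboolP/asboolP; apply: temporally_isomorphic_trans => //.
exact: temporally_isomorphic_sym.
Qed.

Lemma edge_set_iso (G H : graph) (phi : G -> H) (e : {set G}) :
  graph_iso phi -> (phi @: e \in edge_set H) = (e \in edge_set G).
Proof.
move=> [[psi fK gK] af]; apply/idP/idP.
  case/imset2P=> x y _; rewrite inE /= => xy E.
  have -> : e = [set psi x; psi y].
    have -> : e = psi @: (phi @: e).
      by rewrite -imset_comp (eq_imset (g := id)) ?imset_id.
    by rewrite E imsetU !imset_set1.
  by rewrite edge_setP -af !gK.
case/imset2P=> x y _; rewrite inE /= => xy ->.
by rewrite imsetU !imset_set1 edge_setP af.
Qed.

Lemma relabel (N : temporal_network) (G : graph) (phi : N -> G) :
  graph_iso phi ->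
  exists t : labeling G, temporally_isomorphic N (TemporalNetwork t).
Proof.
move=> iso; have [[psi fK gK] af] := iso.
have isoV : graph_iso psi.
  by split; [exists phi | move=> x y; rewrite -af !gK].
have fKs : cancel (fun e : {set N} => phi @: e) (fun e : {set G} => psi @: e).
  by move=> e; rewrite -imset_comp (eq_imset (g := id)) ?imset_id.
have gKs : cancel (fun e : {set G} => psi @: e) (fun e : {set N} => phi @: e).
  by move=> e; rewrite -imset_comp (eq_imset (g := id)) ?imset_id.
have card : #|edge_set N| = #|edge_set G|.
  rewrite -(card_imset _ (can_inj fKs)); apply: eq_card => e.
  rewrite -[e in RHS]gKs edge_set_iso //.
  by rewrite -[e in LHS]gKs mem_imset //; exact: can_inj fKs.
have eP (e : edge G) : psi @: val e \in edge_set N by rewrite edge_set_iso //; exact: (svalP e).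
have eP' (e : edge N) : phi @: val e \in edge_set G by rewrite edge_set_iso //; exact: (svalP e).
pose h (e : edge G) : edge N := Sub (psi @: val e) (eP e).
have bh : bijective h.
  exists (fun e : edge N => Sub (phi @: val e) (eP' e) : edge G) => e; apply: val_inj => /=.
    exact: gKs.
  exact: fKs.
pose t := [ffun e : edge G => cast_ord card (val (network_labeling N) (h e))].
have tP : `[< bijective t >].
  apply/asboolP; apply: (@eq_bij _ _ (cast_ord card \o (val (network_labeling N) \o h))).
    apply: bij_comp; last apply: bij_comp => //.
      by exists (cast_ord (esym card)); [exact: cast_ordK | exact: cast_ordKV].
    exact/asboolP/(valP (network_labeling N)).
  by move=> e; rewrite ffunE.
exists (Sub t tP : labeling G); exists phi => // v p.
have lab (e : {set N}) : e \in edge_set N ->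
    @label (TemporalNetwork (Sub t tP : labeling G)) (phi @: e) = label e.
  move=> eE; rewrite /label !insubT ?edge_set_iso //= => H.
  rewrite ffunE /=; do 3 f_equal.
  by apply: val_inj => /=; exact: fKs.
case/andP=> pv; rewrite /temporal_path => sv; apply/andP; split.
  by rewrite path_map (eq_path (e' := @adj N)).
suff -> : [seq @label (TemporalNetwork (Sub t tP : labeling G)) e
            | e <- path_edges (phi v) (map phi p)]
          = [seq label e | e <- path_edges v p] by [].
elim: p v pv {sv} => //= y p IH v /andP[vy yp]; rewrite IH //; congr (_ :: _).
by rewrite -lab ?edge_setP // imsetU !imset_set1.
Qed.

(* Main.v *)
(** A graph isomorphism is a temporal isomorphism exactly when it preserves the
    order of the labels of any two edges sharing a vertex. On a diaster it can
    permute the leaves at either center to match any two orderings, so the class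
    of a labeling is determined by how many peripheral edges at u, respectively
    at w, precede the central edge. Every pair of counts occurs; when a = b the
    reflection identifies (i, j) with (j, i), and otherwise the degrees of u and
    w keep the pair ordered. *)
Require Import Defs.
From mathcomp Require Import all_boot all_order all_algebra.
From mathcomp Require Import boolp zify lra.

Set Implicit Arguments.
Unset Strict Implicit.
Unset Printing Implicit Defensive.

(** * Counting classes through a complete invariant *)

(** The classes of [R] are the nonempty fibers of [f], one for each attained value. *)
Lemma card_equivalence_partition_fibers (T rT : finType) (f : T -> rT)
    (R : rel T) :
  (forall x y, R x y = (f x == f y)) ->
  #|equivalence_partition R [set: T]| = #|f @: [set: T]|.
Proof.
move=> Rf; pose F v := [set y | f y == v].
have -> : equivalence_partition R [set: T] = F @: (f @: [set: T]).
  rewrite -imset_comp; apply: eq_imset => x /=.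
  by apply/setP=> y; rewrite !inE Rf eq_sym.
apply: card_in_imset => _ _ /imsetP[x _ ->] /imsetP[y _ ->] /setP/(_ x).
by rewrite !inE eqxx => /esym/eqP.
Qed.

(** Each [j] admits [j.+1] values of [i], which gives a triangular number; doubling it avoids
    division in [nat]. *)
Lemma leq_pairs_card n :
  #|[set p : 'I_n.+1 * 'I_n.+1 | p.1 <= p.2]|.*2 = n.+1 * n.+2.
Proof.
have -> : #|[set p : 'I_n.+1 * 'I_n.+1 | p.1 <= p.2]| = \sum_(j < n.+1) j.+1.
  have -> : #|[set p : 'I_n.+1 * 'I_n.+1 | p.1 <= p.2]| =
            \sum_(i < n.+1) \sum_(j < n.+1 | i <= j) 1.
    by rewrite pair_big_dep -sum1dep_card.
  rewrite (exchange_big_dep predT) //=; apply: eq_bigr => j _.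
  rewrite -(big_ord_widen n.+1 (fun _ => 1) (ltn_ord j)).
  by rewrite sum1_card card_ord.
elim: n => [|n IH]; first by rewrite big_ord_recr big_ord0.
by rewrite big_ord_recr /= doubleD IH -muln2; lia.
Qed.

(** * Ranks and matchings of injective sequences *)

Section Rank.
Variables (n : nat) (f : 'I_n -> nat) (c : nat).
Hypothesis f_inj : injective f.

Let rank_subproof x : #|[set y | f y < f x]| < n.
Proof.
rewrite -[X in _ < X]card_ord -cardsT; apply: proper_card.
by apply/properP; split; [exact/subsetP | exists x; rewrite ?inE ?ltnn].
Qed.

Definition rank x : 'I_n := Ordinal (rank_subproof x).

Lemma ltn_rank x y : (rank x < rank y) = (f x < f y).
Proof.
apply/idP/idP => [|xy].
  apply: contraTT; rewrite -!leqNgt => yx /=.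
  by apply/subset_leq_card/subsetP => z; rewrite !inE => /leq_trans; apply.
apply: proper_card; apply/properP; split; last by exists x; rewrite !inE ?ltnn.
by apply/subsetP => z; rewrite !inE => /ltn_trans; apply.
Qed.

Lemma rank_inj : injective rank.
Proof.
move=> x y /(congr1 val) E; apply: f_inj; apply/eqP.
by rewrite eqn_leq leqNgt -ltn_rank E ltnn leqNgt -ltn_rank E ltnn.
Qed.

(** The values below [c] occupy an initial segment of the ranks, so a threshold on values becomes a
    threshold on ranks. *)
Lemma ltn_rank_card x : (rank x < #|[set y | f y < c]|) = (f x < c).
Proof.
apply/idP/idP => [|xc].
  apply: contraTT; rewrite -!leqNgt => cx /=.
  by apply/subset_leq_card/subsetP => z; rewrite !inE => /leq_trans; apply.
apply: proper_card; apply/properP; split; last by exists x; rewrite !inE ?ltnn.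
by apply/subsetP => z; rewrite !inE => /ltn_trans; apply.
Qed.

End Rank.

(** Sending each index to the one of the same rank for [g] preserves the order; since equally many
    values lie below the two thresholds, it also preserves the side of the threshold. *)
Lemma order_matching n (f g : 'I_n -> nat) c d :
  injective f -> injective g ->
  (forall x, f x != c) -> (forall x, g x != d) ->
  #|[set x | f x < c]| = #|[set x | g x < d]| ->
  exists p : 'I_n -> 'I_n,
    [/\ bijective p, forall x y, (g (p x) < g (p y)) = (f x < f y),
        forall x, (g (p x) < d) = (f x < c)
      & forall x, (d < g (p x)) = (c < f x)].
Proof.
move=> f_inj g_inj f_neq g_neq fg.
have [r rK Kr] := injF_bij (@rank_inj _ _ g_inj).
have lt x : (g (r (rank f x)) < d) = (f x < c).
  by rewrite -ltn_rank_card Kr -fg ltn_rank_card.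
exists (r \o rank f); split=> [|x y|x|x] //=.
- apply: bij_comp; first by exists (rank g).
  exact/injF_bij/rank_inj.
- by rewrite -[LHS]ltn_rank !Kr ltn_rank.
(* Without ties at the thresholds, lying above is the negation of lying below. *)
- have := lt x; have := f_neq x; have := g_neq (r (rank f x)).
  by case: ltngtP => // _ _; case: ltngtP.
Qed.

(** * Temporal isomorphisms as local order isomorphisms *)

Section TemporalNetworks.
Implicit Types N M : temporal_network.

Definition preserves_order N M (phi : N -> M) := forall x y z : N,
  adj x y -> adj y z ->
  (label [set phi x; phi y] < label [set phi y; phi z]) =
  (label [set x; y] < label [set y; z]).

(** Paths of length 2 give one implication; the converse comes from the reversed path through [z],
    [y], [x]. *)
Lemma temporal_path_order N M (phi : N -> M) : graph_iso phi ->
  (forall v p, temporal_path v p -> temporal_path (phi v) (map phi p)) ->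
  preserves_order phi.
Proof.
move=> [_ af] pf.
have lt x y z : adj x y -> adj y z -> label [set x; y] < label [set y; z] ->
    label [set phi x; phi y] < label [set phi y; phi z].
  move=> xy yz xyz; have := pf x [:: y; z].
  rewrite /= !temporal_path_cons xy xyz /temporal_path /= yz => /(_ isT).
  by case/and3P.
move=> x y z xy yz; apply/idP/idP; last exact: lt.
apply: contraTT; rewrite -!leqNgt leq_eqVlt => /orP[/eqP E|gt].
  (* Equal labels mean equal edges, hence [x = z], and the two image edges coincide as well. *)
  have /setP/(_ x) : [set y; z] = [set x; y].
    by apply: label_inj; rewrite ?edge_setP.
  rewrite !inE eqxx /= => /orP[] /eqP xE; last by rewrite xE setUC.
  by move: xy; rewrite xE adj_irrefl.
apply: ltnW; rewrite setUC [X in _ < label X]setUC; apply: lt.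
- by rewrite adj_sym.
- by rewrite adj_sym.
- by rewrite setUC [X in _ < label X]setUC.
Qed.

(** Increasing labels along a path are a condition on consecutive edges, which share a vertex. *)
Lemma order_temporally_isomorphic N M (phi : N -> M) :
  graph_iso phi -> preserves_order phi -> temporally_isomorphic N M.
Proof.
move=> iso lt; exists phi => // v p; have [_ af] := iso.
elim: p v => [|y [|z p] IH] x //; first by rewrite /temporal_path /= af.
rewrite /= !temporal_path_cons af => /and3P[xy xyz yzp].
by rewrite xy lt ?xyz ?IH //; case/andP: yzp => /andP[].
Qed.

(** The strict inequality excludes [z = y]; with [x] and [y] the two centers, only leaves at [x] are
    counted. *)
Definition earlier N (x y : N) :=
  #|[set z | adj z x && (label [set z; x] < label [set x; y])]|.

Lemma earlier_iso N M (phi : N -> M) (x y : N) :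
  graph_iso phi -> preserves_order phi -> adj x y ->
  earlier (phi x) (phi y) = earlier x y.
Proof.
move=> [[psi fK gK] af] lt xy; rewrite /earlier -(card_imset _ (can_inj fK)).
apply: eq_card => z; rewrite -[z]gK (mem_imset _ _ (can_inj fK)) !inE af.
by case: adj (lt (psi z) x y) => //= ->.
Qed.

Lemma labelE (G : graph) (s : labeling G) e (eE : e \in edge_set G) :
  @label (TemporalNetwork s) e = (val s (Sub e eE)).+1.
Proof. by rewrite /label insubT. Qed.

(** Labeling each edge by the rank of its key allows keys with gaps, so labelings can be prescribed
    by their order alone. *)
Lemma labeling_of_key (G : graph) (k : {set G} -> nat) :
  {in edge_set G &, injective k} ->
  exists s : labeling G, {in edge_set G &, forall e f,
    (@label (TemporalNetwork s) e < @label (TemporalNetwork s) f) = (k e < k f)}.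
Proof.
move=> k_inj.
pose m := #|edge_set G|.
have r_subproof (e : edge G) : #|[set f in edge_set G | k f < k (val e)]| < m.
  apply: proper_card; apply/properP; split.
    by apply/subsetP => f; rewrite !inE => /andP[].
  by exists (val e); rewrite ?inE ?ltnn ?andbF //; exact: (svalP e).
pose r := [ffun e : edge G => Ordinal (r_subproof e)].
have ltr e f : (r e < r f) = (k (val e) < k (val f)).
  rewrite !ffunE /=; apply/idP/idP => [|ef].
    apply: contraTT; rewrite -!leqNgt => fe.
    apply/subset_leq_card/subsetP => g; rewrite !inE.
    by case/andP=> -> /leq_trans; apply.
  apply: proper_card; apply/properP; split.
    apply/subsetP => g; rewrite !inE.
    by case/andP=> -> /ltn_trans; apply.
  by exists (val e); rewrite !inE ?ltnn ?andbF // ef andbT; exact: (svalP e).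
have r_bij : `[< bijective r >].
  apply/asboolP/inj_card_bij.
    move=> e f E; apply/val_inj/k_inj; [exact: (svalP e)|exact: (svalP f)|].
    by apply/eqP; rewrite eqn_leq leqNgt -ltr E ltnn leqNgt -ltr E ltnn.
  by rewrite card_ord card_sig /m cardE -cardE.
pose s : labeling G := Sub r r_bij; have sr : val s = r by [].
exists s => e f eE fE; rewrite !labelE sr.
exact: (ltr (Sub e eE) (Sub f fE)).
Qed.

End TemporalNetworks.

(** * The pair of counts as an invariant of diaster labelings *)

Section Diaster.
Variables a b : nat.
Local Notation D := (diaster a b).
Local Notation u := (inl false : D).
Local Notation w := (inl true : D).
Local Notation lu i := (inr (inl i) : D).
Local Notation lw j := (inr (inr j) : D).
Local Notation net := (@TemporalNetwork D).

(** The default of [inord] never occurs, since each count is at most the number of leaves at that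
    center. *)
Definition before_center (s : labeling D) : 'I_a.+1 * 'I_b.+1 :=
  (inord (@earlier (net s) u w), inord (@earlier (net s) w u)).

Lemma earlier_uE (s : labeling D) : @earlier (net s) u w =
  #|[set i : 'I_a | @label (net s) [set lu i; u] < @label (net s) [set u; w]]|.
Proof.
have inj : injective (fun i : 'I_a => lu i) by move=> i j [].
rewrite -(card_imset _ inj); apply: eq_card => -[c|[i|j]]; rewrite inE /=.
- case: c => /=; rewrite ?[[set w; _]]setUC ?ltnn;
    by apply/esym/negbTE/imsetP => -[].
- by rewrite (mem_imset _ _ inj) inE.
- by apply/esym/negbTE/imsetP => -[].
Qed.

Lemma earlier_wE (s : labeling D) : @earlier (net s) w u =
  #|[set j : 'I_b | @label (net s) [set lw j; w] < @label (net s) [set w; u]]|.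
Proof.
have inj : injective (fun i : 'I_b => lw i) by move=> i j [].
rewrite -(card_imset _ inj); apply: eq_card => -[c|[i|j]]; rewrite inE /=.
- case: c => /=; rewrite ?[[set w; _]]setUC ?ltnn;
    by apply/esym/negbTE/imsetP => -[].
- by apply/esym/negbTE/imsetP => -[].
- by rewrite (mem_imset _ _ inj) inE.
Qed.

Lemma before_centerE (s : labeling D) :
  (val (before_center s).1 = @earlier (net s) u w) *
  (val (before_center s).2 = @earlier (net s) w u).
Proof.
split; rewrite /= inordK // ?earlier_uE ?earlier_wE ltnS;
  by rewrite -[X in _ <= X]card_ord max_card.
Qed.

Lemma set2_injl (T : finType) (x y z : T) :
  [set x; z] = [set y; z] -> x = y.
Proof.
move=> E; have /setP/(_ x) := E; have /setP/(_ y) := E.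
by rewrite !inE !eqxx /= => /orP[] /eqP-> // /esym/orP[] /eqP.
Qed.

(** The leaves at each center are matched by [order_matching], with the label of the central edge as
    threshold. *)
Lemma same_before_center (s t : labeling D) :
  before_center s = before_center t -> temporally_isomorphic (net s) (net t).
Proof.
move=> E.
have [Eu Ew] : (@earlier (net s) u w = @earlier (net t) u w) /\
               (@earlier (net s) w u = @earlier (net t) w u).
  by rewrite -!before_centerE E.
have adj_label (r : labeling D) (x y z : D) : adj x y -> adj z y ->
    @label (net r) [set x; y] = @label (net r) [set z; y] -> x = z.
  by move=> xy zy /label_inj-/(_ _ _)/set2_injl; rewrite !edge_setP => /(_ xy zy).
have inju (r : labeling D) :
    injective (fun i : 'I_a => @label (net r) [set lu i; u]).
  by move=> i j /adj_label-/(_ isT isT)[].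
have injw (r : labeling D) :
    injective (fun j : 'I_b => @label (net r) [set lw j; w]).
  by move=> i j /adj_label-/(_ isT isT)[].
have nequ (r : labeling D) (i : 'I_a) :
    @label (net r) [set lu i; u] != @label (net r) [set u; w].
  by apply/eqP; rewrite [[set u; w]]setUC => /adj_label-/(_ isT isT).
have neqw (r : labeling D) (j : 'I_b) :
    @label (net r) [set lw j; w] != @label (net r) [set w; u].
  by apply/eqP; rewrite [[set w; u]]setUC => /adj_label-/(_ isT isT).
rewrite !earlier_uE in Eu; rewrite !earlier_wE in Ew.
have [p [bp pp pc cp]] :=
  order_matching (inju s) (inju t) (nequ s) (nequ t) Eu.
have [q [bq qq qc cq]] :=
  order_matching (injw s) (injw t) (neqw s) (neqw t) Ew.
pose phi (x : D) : D := match x with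
  | inl c => inl c | inr (inl i) => lu (p i) | inr (inr j) => lw (q j) end.
have iso : graph_iso phi.
  split; last by case=> [c|[i|j]] [d|[k|l]].
  have [p' pK Kp] := bp; have [q' qK Kq] := bq.
  exists (fun x : D => match x with
    | inl c => inl c | inr (inl i) => lu (p' i) | inr (inr j) => lw (q' j) end).
    by case=> [c|[i|j]] //=; rewrite ?pK ?qK.
  by case=> [c|[i|j]] //=; rewrite ?Kp ?Kq.
apply: (@order_temporally_isomorphic (net s) (net t) phi iso).
(* When the middle vertex [y] is a leaf, [x] and [z] are both its unique neighbor and neither
   inequality holds. *)
move=> x y z; case: y => [c|[i|j]].
- case: x => [d|[i|j]]; case: z => [e|[k|l]]; case: c => //;
    try case: d => //; try case: e => //; move=> _ _ /=.
  + by rewrite setUC !ltnn.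
  + by rewrite setUC !ltnn.
  + by rewrite setUC [X in _ < label X]setUC [X in _ = (_ < label X)]setUC cp.
  + by rewrite setUC [X in _ < label X]setUC [X in _ = (_ < label X)]setUC cq.
  + exact: pc.
  + by rewrite [X in _ < label X]setUC [X in _ = (_ < label X)]setUC pp.
  + exact: qc.
  + by rewrite [X in _ < label X]setUC [X in _ = (_ < label X)]setUC qq.
- case: x => [[]|[?|?]] //; case: z => [[]|[?|?]] // _ _.
  by rewrite [[set phi u; _]]setUC [[set u; _]]setUC !ltnn.
- case: x => [[]|[?|?]] //; case: z => [[]|[?|?]] // _ _.
  by rewrite [[set phi w; _]]setUC [[set w; _]]setUC !ltnn.
Qed.

Lemma before_center_onto ij : exists s, before_center s = ij.
Proof.
case: ij => i j.
(* The early leaf edges get keys 1, ..., a + b, the central edge a + b + 1, and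
   the late leaf edges larger keys. The centers have key 0, so that the maximum
   over an edge other than the central one is the key of its leaf. *)
pose kv (x : D) := match x with
  | inl _ => 0
  | inr (inl k) => if k < i then k.+1 else (a + b + k).+2
  | inr (inr l) => if l < j then (a + l).+1 else (a + b + a + l).+2
  end.
pose k (e : {set D}) :=
  if e == [set u; w] then (a + b).+1 else \max_(x in e) kv x.
have kc : k [set u; w] = (a + b).+1 by rewrite /k eqxx.
have ku x : k [set lu x; u] = kv (lu x).
  rewrite /k ifF ?big_setU1 ?big_set1 ?inE ?maxn0 //.
  by apply/negP => /eqP/setP/(_ (lu x)); rewrite !inE eqxx.
have kw x : k [set lw x; w] = kv (lw x).
  rewrite /k ifF ?big_setU1 ?big_set1 ?inE ?maxn0 //.
  by apply/negP => /eqP/setP/(_ (lw x)); rewrite !inE eqxx.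
have edgeP (e : {set D}) : e \in edge_set D ->
    [\/ e = [set u; w], exists x : 'I_a, e = [set lu x; u]
      | exists x : 'I_b, e = [set lw x; w]].
  case/imset2P=> x y _; rewrite inE /= => xy ->.
  case: x y xy => [[]|[x|x]] [[]|[y|y]] //= _;
    by [constructor 1; rewrite // setUC
       | constructor 2; eexists; rewrite // setUC
       | constructor 3; eexists; rewrite // setUC].
have k_inj : {in edge_set D &, injective k}.
  move=> e f /edgeP eE /edgeP fE.
  case: eE fE => [->|[x ->]|[x ->]] [->|[y ->]|[y ->]];
    rewrite ?kc ?ku ?kw /= => E //.
  (* Edges of different kinds have keys in disjoint ranges. *)
  1-3,5-7: by exfalso; move: E; try have := ltn_ord x; try have := ltn_ord y;
    clear; repeat case: ltnP => ?; lia.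
  1,2: suff /val_inj-> : x = y :> nat by [].
  1,2: move: E (ltn_ord x) (ltn_ord y); clear; repeat case: ltnP => ?; lia.
have [s sk] := labeling_of_key k_inj; exists s.
have card_lt n (m : 'I_n.+1) : #|[set x : 'I_n | x < m]| = m.
  rewrite -sum1dep_card -(big_ord_widen n (fun _ => 1)); last by rewrite -ltnS.
  by rewrite sum1_card card_ord.
apply/pair_equal_spec; split; apply: val_inj; rewrite before_centerE.
- rewrite earlier_uE -[RHS]card_lt; apply: eq_card => x.
  rewrite !inE sk ?edge_setP // kc ku /=.
  by have := ltn_ord x; case: (ltnP x i) => ?; lia.
- rewrite earlier_wE -[RHS]card_lt; apply: eq_card => x.
  rewrite !inE [[set w; u]]setUC sk ?edge_setP // kc kw /=.
  by have := ltn_ord x; case: (ltnP x j) => ?; lia.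
Qed.

(* The hypothesis excludes the stars: if exactly one of a and b is 0, one of the
   two centers is itself a leaf. *)
Lemma graph_iso_center (phi : D -> D) c : (0 < a) = (0 < b) ->
  graph_iso phi -> exists d, phi (inl c) = inl d.
Proof.
move=> ab [bphi af].
case E : (phi (inl c)) => [d|l]; first by exists d.
exfalso.
have [x xc] : exists x : 'I_a + 'I_b, adj (inl c : D) (inr x).
  (* The leaf [l] shows that [a] and [b] are not both 0. *)
  have [ha hb] : 0 < a /\ 0 < b.
    by move: ab; case: l {E} => -[m ml]; case: posnP; case: posnP; lia.
  by case: c {E}; [exists (inr (Ordinal hb)) | exists (inl (Ordinal ha))].
(* The other center and the leaf [x] are distinct neighbors of [inl c], but their images would both
   be the only neighbor of the leaf [l]. *)
have lc : adj (inr l : D) (phi (inl (~~ c))) by rewrite -E af /=; case: (c).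
have lx : adj (inr l : D) (phi (inr x)) by rewrite -E af.
suff /(bij_inj bphi) : phi (inl (~~ c)) = phi (inr x) by [].
by move: lc lx; case: l {E} => m; case: (phi _) => [[]|[?|?]] //;
  case: (phi _) => [[]|[?|?]].
Qed.

(** The isomorphism permutes the two centers and preserves [earlier]: fixing them keeps the pair,
    exchanging them swaps it. *)
Lemma isotemporal_before_center (s t : labeling D) : (0 < a) = (0 < b) ->
  temporally_isomorphic (net s) (net t) ->
  before_center s = before_center t \/
  a = b /\ (val (before_center s).1 = (before_center t).2 /\
             val (before_center s).2 = (before_center t).1).
Proof.
move=> ab [phi iso /(temporal_path_order iso) ord]; have [bphi af] := iso.
have [c pc] := graph_iso_center false ab iso.
have [d pd] := graph_iso_center true ab iso.
have cd : c != d by have := af u w; rewrite pc pd.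
have := earlier_iso iso ord (isT : adj (u : net s) w).
have := earlier_iso iso ord (isT : adj (w : net s) u).
rewrite pc pd; case: c d cd pc pd => [] [] // _ pc pd Ew Eu; last first.
  by left; apply/pair_equal_spec; split; apply: val_inj; rewrite !before_centerE.
right; rewrite !before_centerE; split=> //.
(* Exchanged centers have equal degrees, [a.+1] and [b.+1]. *)
have deg (x : D) : #|[set y | adj (phi x) y]| = #|[set y | adj x y]|.
  rewrite -[RHS](card_imset _ (bij_inj bphi)); have [psi fK gK] := bphi.
  apply: eq_card => y; rewrite -[y]gK (mem_imset _ _ (bij_inj bphi)) !inE.
  exact: af.
have degu : #|[set y | adj u y]| = a.+1.
  rewrite -sum1dep_card big_mkcond big_sumType big_sumType big_bool /=.
  by rewrite !sum_nat_const !card_ord; lia.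
have degw : #|[set y | adj w y]| = b.+1.
  rewrite -sum1dep_card big_mkcond big_sumType big_sumType big_bool /=.
  by rewrite !sum_nat_const !card_ord; lia.
by have := deg u; rewrite pc degu degw => -[].
Qed.

End Diaster.

(** * The symmetric case: unordered pairs of counts *)

Section SymmetricDiaster.
Variable a : nat.
Local Notation D := (diaster a a).
Local Notation net := (@TemporalNetwork D).

Lemma before_center_swap (s : labeling D) : exists2 t : labeling D,
  temporally_isomorphic (net s) (net t) &
  before_center t = ((before_center s).2, (before_center s).1).
Proof.
pose phi (x : D) : D := match x with
  | inl c => inl (~~ c) | inr (inl i) => inr (inr i) | inr (inr i) => inr (inl i)
  end.
have phiK : involutive phi by case=> [[]|[]].
have iso : graph_iso phi.
  by split; [exists phi | case=> [[]|[i|i]] [[]|[j|j]]].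
have phisK : involutive (fun e : {set D} => phi @: e).
  by move=> e; rewrite -imset_comp (eq_imset (g := id)) ?imset_id.
(* As the reflection [phi] is an involution, reading [s] at the reflected edge transports [s] along
   [phi]. *)
have [|t tk] := @labeling_of_key D (fun e => @label (net s) (phi @: e)).
  move=> e f eE fE /label_inj E; apply: (can_inj phisK); apply: E;
    by rewrite (edge_set_iso _ iso).
have ord : @preserves_order (net s) (net t) phi.
  move=> x y z xy yz; rewrite tk ?edge_setP ?iso.2 //.
  by rewrite !imsetU !imset_set1 !phiK.
exists t.
  exact: (@order_temporally_isomorphic (net s) (net t) phi iso ord).
have := @earlier_iso (net s) (net t) phi (inl false) (inl true) iso ord isT.
have := @earlier_iso (net s) (net t) phi (inl true) (inl false) iso ord isT.
move=> /= E1 E2.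
by apply/pair_equal_spec; split; apply: val_inj; rewrite !before_centerE.
Qed.

(** Sorting picks a normal form of the unordered pair. *)
Definition sorted_before_center (s : labeling D) : 'I_a.+1 * 'I_a.+1 :=
  let: (i, j) := before_center s in if i <= j then (i, j) else (j, i).

Lemma isotemporal_sorted (s t : labeling D) :
  isotemporal s t = (sorted_before_center s == sorted_before_center t).
Proof.
apply/asboolP/eqP => [/(isotemporal_before_center erefl)|].
  rewrite /sorted_before_center.
  case: (before_center s) (before_center t) => [i j] [k l] /=.
  case=> [[-> ->] //|[_ [/val_inj-> /val_inj->]]].
  by case: ltngtP => // /val_inj->.
have [s' ss' s'E] := before_center_swap s.
have same (x y : labeling D) := @same_before_center a a x y.
move: s'E (same s t) (same s' t); rewrite /sorted_before_center.
case: (before_center s) (before_center t) => [i j] [k l] /= -> st s't.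
(* If both pairs or neither were swapped by sorting, they agree; otherwise the reflected labeling
   [s'] has the pair of [t]. *)
case: leqP => _; case: leqP => _ [? ?]; subst.
1,4: exact: st.
1,2: exact: temporally_isomorphic_trans ss' (s't _).
Qed.

Lemma num_isotemporal_classes_symmetric :
  (num_isotemporal_classes D).*2 = a.+1 * a.+2.
Proof.
rewrite -leq_pairs_card; congr _.*2.
rewrite /num_isotemporal_classes /isotemporal_classes.
rewrite (card_equivalence_partition_fibers isotemporal_sorted).
apply: eq_card => -[i j]; rewrite inE /=; apply/imsetP/idP => [[s _]|ij].
  rewrite /sorted_before_center; case: (before_center s) => k l.
  by case: leqP => [kl|/ltnW lk] [-> ->].
have [s sE] := before_center_onto (i, j); exists s => //.
by rewrite /sorted_before_center sE ij.
Qed.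

End SymmetricDiaster.

(** * The asymmetric case and the final count *)

Lemma num_isotemporal_classes_asymmetric a b : a <> b -> 0 < a -> 0 < b ->
  num_isotemporal_classes (diaster a b) = a.+1 * b.+1.
Proof.
move=> ab a0 b0.
have ltE : (0 < a) = (0 < b) by rewrite a0 b0.
have isoE (s t : labeling (diaster a b)) :
    isotemporal s t = (before_center s == before_center t).
  apply/asboolP/eqP => [/(isotemporal_before_center ltE)[//|[]]//|].
  exact: same_before_center.
rewrite /num_isotemporal_classes /isotemporal_classes.
rewrite (card_equivalence_partition_fibers isoE).
have -> : #|(@before_center a b) @: setT| = #|{: 'I_a.+1 * 'I_b.+1}|.
  apply: eq_card => ij; apply/imsetP.
  by have [s <-] := before_center_onto ij; exists s.
by rewrite card_prod !card_ord.
Qed.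

Theorem theorem1 (a b : nat) :
  (a <> b -> (1 <= a)%N -> (1 <= b)%N ->
     num_isotemporal_classes (diaster a b) = (a * b + a + b + 1)%N) /\
  (a = b ->
     ((num_isotemporal_classes (diaster a a))%:R =
        1 / 2%:R * (a%:R ^+ 2 + 3%:R * a%:R + 2%:R) :> rat)%R).
Proof.
split=> [ab a0 b0|_].
  by rewrite num_isotemporal_classes_asymmetric //; lia.
(* The doubled count is cast into [rat], where it can be halved. *)
have := congr1 (GRing.natmul (1%R : rat)) (num_isotemporal_classes_symmetric a).
rewrite -muln2 !GRing.natrM -(addn1 a.+1) -(addn1 a) !GRing.natrD.
lra.
Qed.
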